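(* Let $\boldsymbol{k}=(k_1,\dots,k_r)$ be an index and $\boldsymbol{x}=(x_1,\dots,x_r)$ a tuple of indeterminates. Then for every positive integer $N$, \[ \sum_{0<n_1<\cdots<n_r\leq N}\frac{1}{n_1^{k_1}\cdots n_r^{k_r}}\left[\prod_{i=1}^{r-1}\frac{\binom{Nx_{i+1}-1}{n_i}}{\binom{Nx_i-1}{n_i}}\right]\frac{\binom{N}{n_r}}{\binom{Nx_r-1}{n_r}} =(-1)^r\sum_{\substack{1\leq n_{j,1}\leq\cdots\leq n_{j,k_j}\leq N \ (1\leq j\leq r)\\ n_{j,k_j}<n_{j+1,1} \ (1\leq j<r)}}\prod_{j=1}^r\frac{1}{(n_{j,1}-Nx_j)n_{j,2}\cdots n_{j,k_j}}, \] the right-hand sum being over integers $n_{j,l}$.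
   Context: An index is a tuple of positive integers. $\binom{x}{n}\coloneqq\frac{x(x-1)\cdots(x-n+1)}{n!}$ for $n\ge1$ and $\binom{x}{0}\coloneqq1$. *)

(* Defs.v *)
From HB Require Import structures.
From mathcomp Require Import all_boot all_order all_algebra.
From mathcomp Require Import fraction mpoly.

Set Implicit Arguments.
Unset Strict Implicit.
Unset Printing Implicit Defensive.

Import GRing.Theory.

Local Open Scope ring_scope.

(* The field Q(x_0, ..., x_{r-1}) of rational functions in r indeterminates. *)
Definition ratfun (r : nat) : fieldType := {fraction {mpoly rat[r]}}.

Definition indet (r : nat) (i : 'I_r) : ratfun r := tofrac ('X_i : {mpoly rat[r]}).

(* x (x - 1) ... (x - n + 1) / n!, which is 1 for n = 0. *)
Definition gbinom (F : fieldType) (x : F) (n : nat) : F :=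
  (\prod_(i < n) (x - i%:R)) / (n`!)%:R.

(* Strictly increasing chains 0 < n_0 < ... < n_{r-1} <= N; the upper bound is
   carried by the type 'I_N.+1. *)
Definition strict_chain (N r : nat) (n : {ffun 'I_r -> 'I_N.+1}) : bool :=
  [forall i : 'I_r, 0 < n i]%N &&
  [forall i : 'I_r, forall j : 'I_r, (i < j)%N ==> (n i < n j)%N].

(* Families (n_{j,l}) with j < r and l < k j, both indices counted from 0. *)
Definition block_family (N r : nat) (k : 'I_r -> nat) : finType :=
  {dffun forall j : 'I_r, {ffun 'I_(k j) -> 'I_N.+1}}.

(* Each block is weakly increasing with entries in [1, N], and the last entry
   of a block is smaller than the first entry of the next one. *)
Definition block_chain (N r : nat) (k : 'I_r -> nat) (n : block_family N k) :
    bool :=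
  [&& [forall j : 'I_r, forall l : 'I_(k j), 0 < n j l]%N,
      [forall j : 'I_r, forall l : 'I_(k j), forall l' : 'I_(k j),
         (l <= l')%N ==> (n j l <= n j l')%N] &
      [forall j : 'I_r, forall j' : 'I_r,
        forall l : 'I_(k j), forall l' : 'I_(k j'),
        [&& j' == j.+1 :> nat, l.+1 == k j & l' == 0%N :> nat]
          ==> (n j l < n j' l')%N]].

(* Main.v *)
(** With y_j = N x_j, both sides are built block by block.  Put v_0 = delta_0
    and v_(j+1)(n) = n^(-k_j) / binom(y_j - 1, n)
                     * sum_(a < n) v_j(a) binom(y_j - 1, a).
    The left-hand side is then the binomial transform
    sum_(a <= m) v_r(a) binom(m, a) at m = N.  Let the upper bound m vary while
    the y_j stay fixed: by Pascal's rule, the difference in m of the transform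
    of v_(j+1) lowers the exponent k_j by one and produces a factor 1/m, and
    when the exponent reaches 0 the inner sum telescopes to m / (y_j - m) times
    the transform of v_j at m - 1.  Up to the sign (-1)^r this is the recursion
    obtained on the right-hand side by removing the largest entry n_(r,k_r). *)
Require Import Defs.
From mathcomp Require Import all_boot all_order all_algebra.
From mathcomp Require Import fraction mpoly zify ring.

Set Implicit Arguments.
Unset Strict Implicit.
Unset Printing Implicit Defensive.

Import GRing.Theory.

Local Open Scope ring_scope.

(** * Splitting off the last coordinate in sums over finite functions *)

Section LastCoordinate.

Variables (n : nat) (T : 'I_n.+1 -> finType).

Definition dffun_rcons (g : {dffun forall i : 'I_n, T (lift ord_max i)})
    (t : T ord_max) : {dffun forall i, T i} :=
  finfun (fun j => match unliftP ord_max j with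
                   | UnliftSome i e => eq_rect_r (fun j => T j) (g i) e
                   | UnliftNone e => eq_rect_r (fun j => T j) t e
                   end).

Lemma dffun_rcons_lift g t i : dffun_rcons g t (lift ord_max i) = g i.
Proof.
rewrite ffunE; case: unliftP => [i' e | e].
  have ii' := lift_inj e; rewrite -{i'}ii' in e *.
  (* Equality proofs between ordinals are unique, so the transport is the identity. *)
  by rewrite (eq_irrelevance e erefl).
by case/eqP: (neq_lift ord_max i).
Qed.

Lemma dffun_rcons_max g t : dffun_rcons g t ord_max = t.
Proof.
rewrite ffunE; case: unliftP => [i' e | e].
  by case/eqP: (neq_lift ord_max i').
by rewrite (eq_irrelevance e erefl).
Qed.

Lemma forall_ord_recr (P : pred 'I_n.+1) :
  [forall i, P i] = [forall i : 'I_n, P (lift ord_max i)] && P ord_max.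
Proof.
apply/forallP/andP => [h | [/forallP h ?] i]; first by split => //; apply/forallP.
by case: (unliftP ord_max i) => [j ->|->].
Qed.

Lemma sum_dffun_recr (V : nmodType) (P : pred {dffun forall i, T i})
    (E : {dffun forall i, T i} -> V) :
  \sum_(f | P f) E f
  = \sum_t \sum_(g | P (dffun_rcons g t)) E (dffun_rcons g t).
Proof.
rewrite pair_big_dep /=.
rewrite (reindex (fun p => dffun_rcons p.2 p.1)) //=.
exists (fun f : {dffun forall i, T i} =>
          (f ord_max, [ffun i => f (lift ord_max i)])) => [[t g] _ | f _] /=.
  congr pair; first exact: dffun_rcons_max.
  by apply/ffunP => i; rewrite ffunE dffun_rcons_lift.
apply/ffunP => j; case: (unliftP ord_max j) => [i ->|->].
  by rewrite dffun_rcons_lift ffunE.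
by rewrite dffun_rcons_max.
Qed.

End LastCoordinate.

Definition ffun_rcons n (T : finType) (g : {ffun 'I_n -> T}) (t : T) :
    {ffun 'I_n.+1 -> T} := @dffun_rcons n (fun=> T) g t.

Lemma sum_ffun_recr n (T : finType) (V : nmodType)
    (P : pred {ffun 'I_n.+1 -> T}) (E : {ffun 'I_n.+1 -> T} -> V) :
  \sum_(f | P f) E f = \sum_t \sum_(g | P (ffun_rcons g t)) E (ffun_rcons g t).
Proof.
(* The maps are identities; they only exchange the finite-type structures of plain and dependent
   functions. *)
rewrite (reindex (fun f : {dffun forall _ : 'I_n.+1, T} => f : {ffun _ -> T}))
  /=; last first.
  by exists (fun f : {ffun _ -> T} => f : {dffun forall _ : 'I_n.+1, T}).
rewrite sum_dffun_recr; apply: eq_bigr => t _.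
rewrite (reindex (fun f : {ffun 'I_n -> T} => f : {dffun forall _ : 'I_n, T}))
  //=.
by exists (fun f : {dffun forall _ : 'I_n, T} => f : {ffun _ -> T}).
Qed.

Lemma sum_dffun0 (T : 'I_0 -> finType) (V : nmodType)
    (P : pred {dffun forall i, T i}) (E : {dffun forall i, T i} -> V) f :
  P f -> \sum_(f | P f) E f = E f.
Proof.
move=> Pf; rewrite (big_pred1 f) // => g /=.
have -> : g = f by apply/ffunP; case.
by rewrite Pf eqxx.
Qed.

Lemma sum_ffun0 (T : finType) (V : nmodType) (P : pred {ffun 'I_0 -> T})
    (E : {ffun 'I_0 -> T} -> V) f :
  P f -> \sum_(f | P f) E f = E f.
Proof.
move=> Pf; rewrite (big_pred1 f) // => g /=.
have -> : g = f by apply/ffunP; case.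
by rewrite Pf eqxx.
Qed.

(** * Chains of integers and their recursive sums *)

(* Sum of the products of [e i n_i] over 0 < n_0, n_i + s <= n_(i+1) and
   n_(r-1) + s <= m; [s = 1] gives strict chains and [s = 0] weak ones. *)
Fixpoint chain_sum (F : fieldType) (s : nat) (e : nat -> nat -> F) (r m : nat) :
    F :=
  if r is r'.+1 then \sum_(1 <= t < m.+1 - s) e r' t * chain_sum s e r' t
  else 1.

Definition spaced_chain (s N r m : nat) (n : {ffun 'I_r -> 'I_N.+1}) :=
  [&& [forall i, 0 < n i]%N,
      [forall i : 'I_r, forall j : 'I_r, (i < j)%N ==> (n i + s <= n j)%N] &
      [forall i, n i + s <= m]%N].

(** The gap condition towards the last entry [t] has the form of the upper bound, so [t] becomes the
    bound of the shorter chain. *)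
Lemma spaced_chain_rcons s N r m (g : {ffun 'I_r -> 'I_N.+1}) t :
  spaced_chain s m (ffun_rcons g t)
  = ((0 < t) && (t + s <= m))%N && spaced_chain s t g.
Proof.
have gl i : ffun_rcons g t (lift ord_max i) = g i := dffun_rcons_lift _ _ _.
have gm : ffun_rcons g t ord_max = t := dffun_rcons_max _ _.
apply/and3P/andP => [[/forallP g0 /forallP gi /forallP gb]|
    [/andP[t0 tm] /and3P[/forallP g0 /forallP gi /forallP gb]]].
  split; first by move: (g0 ord_max) (gb ord_max); rewrite gm => -> ->.
  apply/and3P; split; apply/forallP => i; first by rewrite -gl.
    apply/forallP => j; have /forallP/(_ (lift ord_max j)) := gi (lift ord_max i).
    by rewrite !gl !lift_max.
  have /forallP/(_ ord_max) := gi (lift ord_max i).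
  by rewrite gl gm lift_max /= ltn_ord.
split; apply/forallP => i.
- by case: (unliftP ord_max i) => [i' ->|->]; rewrite ?gl ?gm.
- apply/forallP => j; apply/implyP.
  case: (unliftP ord_max i) => [i' ->|->]; case: (unliftP ord_max j) => [j' ->|->];
    rewrite ?gl ?gm ?lift_max //=.
  + by have /forallP/(_ j')/implyP := gi i'.
  + by move=> rj; have := leq_trans rj (ltnW (ltn_ord j')); rewrite ltnn.
  + by rewrite ltnn.
- case: (unliftP ord_max i) => [i' ->|->]; rewrite ?gl ?gm //.
  by have := gb i'; lia.
Qed.

Lemma sum_ord_range (V : nmodType) (N s m : nat) (E : nat -> V) : (m <= N + s)%N ->
  \sum_(t < N.+1 | ((0 < t) && (t + s <= m))%N) E t = \sum_(1 <= t < m.+1 - s) E t.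
Proof.
move=> mN.
rewrite -(big_mkord (fun t => (0 < t) && (t + s <= m))%N E).
rewrite big_nat_cond [RHS]big_nat_cond.
rewrite [RHS](big_nat_widenl _ 0) // [RHS](big_nat_widen _ _ N.+1); last by lia.
rewrite big_nat_cond [RHS]big_nat_cond; apply: eq_bigl => t; lia.
Qed.

Lemma chain_sumE (F : fieldType) s (e : nat -> nat -> F) N r m : (m <= N + s)%N ->
  \sum_(n : {ffun 'I_r -> 'I_N.+1} | spaced_chain s m n) \prod_(i < r) e i (n i)
  = chain_sum s e r m.
Proof.
elim: r m => [|r IHr] m mN.
  rewrite (@sum_ffun0 _ _ _ _ [ffun=> ord0]) ?big_ord0 //.
  by apply/and3P; split; apply/forallP; case.
rewrite sum_ffun_recr /= -(@sum_ord_range _ N) // [RHS]big_mkcond /=; apply: eq_bigr => t _.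
under eq_bigl do rewrite spaced_chain_rcons.
case: ifP => /= [/andP[t0 tm]|_]; last by rewrite big_pred0_eq.
rewrite -IHr; last by have := ltn_ord t; lia.
rewrite mulr_sumr; apply: eq_bigr => g _.
rewrite big_ord_recr /= mulrC; congr (e _ (nat_of_ord _) * _); first exact: dffun_rcons_max.
apply: eq_bigr => i _; congr (e _ (nat_of_ord _)).
have -> : widen_ord (leqnSn r) i = lift ord_max i by exact/val_inj/esym/lift_max.
exact: dffun_rcons_lift.
Qed.

(** In a weak chain the top value [m.+1] may repeat, so removing it from the last place leaves the
    bound unchanged. This is the recursion that [attach_expS] reproduces. *)
Lemma chain_sum0S (F : fieldType) (e : nat -> nat -> F) r m :
  chain_sum 0 e r.+1 m.+1
  = chain_sum 0 e r.+1 m + e r m.+1 * chain_sum 0 e r m.+1.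
Proof. by rewrite /= !subn0 big_nat_recr. Qed.

(** * Binomial transforms and their recursion in the upper bound *)

Section BinomialTransform.

Variable F : fieldType.
Hypothesis natF_neq0 : forall n, n.+1%:R != 0 :> F.

Lemma gbinomS (x : F) n : gbinom x n.+1 = gbinom x n * (x - n%:R) / n.+1%:R.
Proof.
rewrite /gbinom big_ord_recr /= factS natrM invfM; ring.
Qed.

Lemma gbinom_nat N n : gbinom (N%:R : F) n = 'C(N, n)%:R.
Proof.
elim: n => [|n IHn]; first by rewrite /gbinom big_ord0 fact0 bin0 divr1.
rewrite gbinomS IHn; apply: (mulIf (natF_neq0 n)); rewrite divfK //.
case: (leqP n N) => nN; last by rewrite !bin_small ?mul0r // ltnW.
by rewrite -natrB // -!natrM mulnC -mul_bin_left mulnC.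
Qed.

Definition binomial_transform (v : nat -> F) m := \sum_(a < m.+1) v a * 'C(m, a)%:R.

Variable y : F.
Hypothesis y_neq_nat : forall n, y - n.+1%:R != 0.

Lemma gbinom_neq0 n : gbinom (y - 1) n != 0.
Proof.
elim: n => [|n IHn]; first by rewrite /gbinom big_ord0 fact0 divr1 oner_eq0.
rewrite gbinomS mulf_neq0 ?invr_eq0 ?natF_neq0 // mulf_neq0 //.
by rewrite -addrA -opprD nat1r.
Qed.

(** The passage from v_j to v_(j+1). At [n = 0] the empty sum gives 0. *)
Definition attach k (v : nat -> F) n : F :=
  (n%:R ^+ k)^-1 / gbinom (y - 1) n * \sum_(a < n) v a * gbinom (y - 1) a.

(** From [n] to [n.+1] the quotient ['C(m, n)%:R / gbinom (y - 1) n] is multiplied by (m - n)/(y - n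
    - 1). This ratio minus 1 is -(y - m - 1)/(y - n - 1), whose numerator is free of [n], and so the
    sum telescopes. *)
Lemma sum_binomial_ratio m a : (a <= m.+1)%N ->
  \sum_(a <= n < m.+1) 'C(m.+1, n.+1)%:R / gbinom (y - 1) n.+1
  = m.+1%:R / (y - m.+1%:R) * ('C(m, a)%:R / gbinom (y - 1) a).
Proof.
move=> am.
pose T n : F := - (m.+1%:R / (y - m.+1%:R) * ('C(m, n)%:R / gbinom (y - 1) n)).
rewrite (telescope_sumr_eq T) // /T.
  (* The upper end [T m.+1] vanishes because ['C(m, m.+1) = 0]. *)
  by rewrite bin_small // mul0r mulr0 oppr0 add0r opprK.
move=> n /andP[_ nm].
have gn := gbinom_neq0 n; have gn1 := gbinom_neq0 n.+1.
have yn := y_neq_nat n; have ym := y_neq_nat m.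
have e1 : m.+1%:R * 'C(m, n)%:R = n.+1%:R * 'C(m.+1, n.+1)%:R :> F.
  by rewrite -!natrM mul_bin_diag.
have e3 : 'C(m, n)%:R * (m%:R - n%:R) = n.+1%:R * 'C(m, n.+1)%:R :> F.
  by rewrite -natrB // -!natrM mulnC mul_bin_left.
have e4 : gbinom (y - 1) n.+1 = gbinom (y - 1) n * (y - n.+1%:R) / n.+1%:R.
  by rewrite gbinomS -addrA -opprD nat1r.
have n1 := natF_neq0 n.
have -> : 'C(m, n.+1)%:R = 'C(m, n)%:R * (m%:R - n%:R) / n.+1%:R :> F.
  by apply: (mulIf n1); rewrite divfK // e3 mulrC.
have -> : 'C(m.+1, n.+1)%:R = m.+1%:R * 'C(m, n)%:R / n.+1%:R :> F.
  by apply: (mulIf n1); rewrite divfK // e1 mulrC.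
rewrite e4; field.
rewrite !nat1r in n1 ym yn *.
by rewrite gn yn ym n1.
Qed.

(** Once the two sums are exchanged, the sum over [n > a] is evaluated by [sum_binomial_ratio], and
    [gbinom (y - 1) a] cancels. *)
Lemma attach_exp0 v m :
  binomial_transform (attach 0 v) m.+1
  = m.+1%:R / (y - m.+1%:R) * binomial_transform v m.
Proof.
rewrite /binomial_transform big_ord_recl /= {1}/attach big_ord0 mulr0 mul0r add0r.
rewrite mulr_sumr.
have -> : \sum_(i < m.+1) attach 0 v (bump 0 i) * 'C(m.+1, bump 0 i)%:R
  = \sum_(i < m.+1) \sum_(a < m.+1 | (a <= i)%N)
      v a * gbinom (y - 1) a * ('C(m.+1, i.+1)%:R / gbinom (y - 1) i.+1).
  apply: eq_bigr => i _; rewrite /attach /bump /= add1n expr0 invr1 mul1r.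
  rewrite -mulr_suml mulrAC mulrC [_^-1 * _]mulrC; congr (_ * _).
  by rewrite (big_ord_widen _ (fun a => v a * gbinom (y - 1) a) (ltn_ord i)).
rewrite (exchange_big_dep predT) //=; apply: eq_bigr => a _.
rewrite -mulr_sumr.
rewrite -(big_mkord (fun i => a <= i)%N
            (fun i => 'C(m.+1, i.+1)%:R / gbinom (y - 1) i.+1)).
rewrite -(big_nat_widenl a 0 m.+1 predT) // sum_binomial_ratio; last exact: ltnW.
by have := gbinom_neq0 a; move: (y_neq_nat m) => ? ?; field; rewrite nat1r; apply/andP.
Qed.

(** Pascal's rule leaves the extra term ['C(m, n)], which is (n + 1)/(m + 1) times ['C(m.+1, n.+1)];
    the factor n + 1 cancels one power in [attach]. *)
Lemma attach_expS k v m :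
  binomial_transform (attach k.+1 v) m.+1
  = binomial_transform (attach k.+1 v) m
    + m.+1%:R^-1 * binomial_transform (attach k v) m.+1.
Proof.
have -> : binomial_transform (attach k.+1 v) m
  = \sum_(a < m.+2) attach k.+1 v a * 'C(m, a)%:R.
  by rewrite big_ord_recr /= bin_small // mulr0 addr0.
rewrite mulr_sumr -big_split /=; apply: eq_bigr => -[[|n] /= _] _.
  by rewrite /attach big_ord0 !(mulr0, mul0r) addr0.
apply: (mulfI (natF_neq0 m)); rewrite mulrDr mulVKf //.
have -> : attach k v n.+1 = n.+1%:R * attach k.+1 v n.+1.
  by rewrite /attach exprS invfM !mulrA divff ?natF_neq0 // mul1r.
rewrite binS natrD.
have e1 : m.+1%:R * 'C(m, n)%:R = n.+1%:R * ('C(m, n.+1)%:R + 'C(m, n)%:R) :> F.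
  by rewrite -natrD -binS -!natrM mul_bin_diag.
by rewrite mulrDr mulrDr mulrCA [m.+1%:R * (_ * 'C(m, n)%:R)]mulrCA e1; ring.
Qed.

Lemma binomial_transform_attach0 k v : binomial_transform (attach k v) 0 = 0.
Proof. by rewrite /binomial_transform big_ord1 /attach big_ord0 mulr0 mul0r. Qed.

(** One [attach] step produces one block. The argument [t.-1] of [h] encodes that earlier blocks
    stay strictly below the first entry [t]; the sign comes from 1/(y - t) = -1/(t - y). *)
Lemma binomial_transform_attach k v (c : F) (h : nat -> F) m :
  (forall m, binomial_transform v m = c * h m) ->
  binomial_transform (attach k.+1 v) m
  = - c * chain_sum 0
       (fun l t => (if l == 0%N then t%:R - y else t%:R)^-1
                   * (if l == 0%N then h t.-1 else 1)) k.+1 m.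
Proof.
move=> vh; elim: k m => [|k IHk]; elim=> [|m IHm].
- by rewrite binomial_transform_attach0 /= big_nil mulr0.
(* At exponent 1 the factor 1/(m + 1) cancels the numerator in [attach_exp0]. *)
- rewrite attach_expS IHm attach_exp0 vh chain_sum0S mulrDr /= mulr1; congr (_ + _).
  have ym := y_neq_nat m; have mn := natF_neq0 m.
  have my : m.+1%:R - y != 0 by rewrite -oppr_eq0 opprB.
  by field; rewrite !nat1r ym my mn.
- by rewrite binomial_transform_attach0 /= big_nil mulr0.
- by rewrite attach_expS IHm IHk [in RHS]chain_sum0S mulrDr /= mulr1 mulrCA.
Qed.

End BinomialTransform.

(** * Families of blocks and their recursive sums *)

Lemma block_chainP N r (k : 'I_r -> nat) (n : block_family N k) :
  reflect [/\ forall j l, (0 < n j l)%N,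
              forall j (l l' : 'I_(k j)), (l <= l')%N -> (n j l <= n j l')%N
            & forall (j j' : 'I_r) (l : 'I_(k j)) (l' : 'I_(k j')),
                j' = j.+1 :> nat -> l.+1 = k j -> l' = 0%N :> nat ->
                (n j l < n j' l')%N]
          (block_chain n).
Proof.
apply: (iffP and3P) => [[/forallP n0 /forallP ni /forallP nb]|[n0 ni nb]]; split.
- by move=> j l; have /forallP := n0 j; apply.
- by move=> j l l'; have /forallP/(_ l)/forallP/(_ l')/implyP := ni j.
- move=> j j' l l' jj' lk l0.
  have /forallP/(_ j')/forallP/(_ l)/forallP/(_ l')/implyP := nb j.
  by apply; apply/and3P; split; apply/eqP.
- by apply/forallP => j; apply/forallP => l.
- by apply/forallP => j; apply/forallP => l; apply/forallP => l'; apply/implyP/ni.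
- apply/forallP => j; apply/forallP => j'; apply/forallP => l; apply/forallP => l'.
  by apply/implyP => /and3P[/eqP ? /eqP ? /eqP ?]; apply: nb.
Qed.

(** Only consecutive blocks are compared by [block_chain]. Induction on [j'] passes through the
    block just before it, which has an entry since [k] is positive. *)
Lemma block_chain_lt N r (k : 'I_r -> nat) (n : block_family N k) :
  (forall j, 0 < k j)%N -> block_chain n ->
  forall (j j' : 'I_r) l l', (j < j')%N -> (n j l < n j' l')%N.
Proof.
move=> k0 /block_chainP[n0 ni nb] j j' l.
have [d] := ubnP (val j'); elim: d => // d IHd in j' * => j'd l' jj'.
have first_lt (i : 'I_r) (l1 : 'I_(k i)) : j' = i.+1 :> nat -> (n i l1 < n j' l')%N.
  move=> ij'.
  have klt : ((k i).-1 < k i)%N by rewrite prednK.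
  apply: (@leq_ltn_trans (n i (Ordinal klt))); first by apply: ni; rewrite /= -ltnS prednK.
  apply: (@leq_trans (n j' (Ordinal (k0 j')))); last exact: ni.
  by apply: nb; rewrite //= prednK.
have j'0 : (0 < j')%N by apply: leq_ltn_trans jj'.
have plt : (j'.-1 < r)%N by apply: leq_ltn_trans (ltn_ord j'); apply: leq_pred.
have j'E : j' = (Ordinal plt).+1 :> nat by rewrite /= prednK.
have [jp|jp] := eqVneq j (Ordinal plt).
  by apply: first_lt; rewrite jp.
have jlt : (j < Ordinal plt)%N.
  by rewrite ltn_neqAle (jp : val j != _) /= -ltnS prednK.
apply: ltn_trans (first_lt (Ordinal plt) (Ordinal (k0 _)) j'E).
by apply: IHd => //; rewrite -ltnS -j'E.
Qed.

Definition bounded_block_chain N r (k : 'I_r -> nat) m (n : block_family N k) :=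
  block_chain n && [forall j, forall l, (n j l <= m)%N].

(** Being below the first entry of the last block is, as that entry is positive, the same as being
    bounded by its predecessor; this is the bound for the remaining blocks. *)
Lemma bounded_block_chain_rcons N r (k : 'I_r.+1 -> nat)
    (k0 : forall j, (0 < k j)%N) m
    (f : block_family N (fun j : 'I_r => k (lift ord_max j)))
    (g : {ffun 'I_(k ord_max) -> 'I_N.+1}) :
  bounded_block_chain m (dffun_rcons f g : block_family N k)
  = spaced_chain 0 m g && bounded_block_chain (g (Ordinal (k0 ord_max))).-1 f.
Proof.
pose h := (dffun_rcons f g : block_family N k).
have hl i : h (lift ord_max i) = f i := dffun_rcons_lift _ _ _.
have hm : h ord_max = g := dffun_rcons_max _ _.
rewrite -/h; apply/andP/andP => [[hc /forallP hb]|
    [/and3P[/forallP g0 /forallP gi /forallP gb]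
     /andP[/block_chainP[f0 fi fb] /forallP fg]]].
  have hlt := block_chain_lt k0 hc.
  case/block_chainP: hc => h0 hi hn; split.
    apply/and3P; split; apply/forallP => l.
    - by rewrite -hm h0.
    - apply/forallP => l'; apply/implyP => /ltnW ll'; rewrite addn0 -hm; exact: hi.
    - by rewrite addn0 -hm; have /forallP := hb ord_max; apply.
  apply/andP; split.
    apply/block_chainP; split.
    - by move=> j l; rewrite -hl h0.
    - by move=> j l l' ll'; rewrite -hl hi.
    - move=> j j' l l' jj' lk l'0; rewrite -!hl; apply: hn => //.
      by rewrite !lift_max.
  apply/forallP => j; apply/forallP => l; rewrite -hl -hm.
  rewrite -ltnS prednK //; apply: hlt.
  by rewrite lift_max.
have g1 l : (0 < g l)%N := g0 l.
split.
  apply/block_chainP; split.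
  - by move=> j; case: (unliftP ord_max j) => [i ->|->] l; rewrite ?hl ?hm.
  - move=> j; case: (unliftP ord_max j) => [i ->|->] l l' ll'; rewrite ?hl ?hm.
      exact: fi.
    have [-> //|ne] := eqVneq l l'.
    have /forallP/(_ l')/implyP := gi l; rewrite addn0; apply.
    by rewrite ltn_neqAle ll' andbT.
  - move=> j j'; case: (unliftP ord_max j) => [i ->|->];
      case: (unliftP ord_max j') => [i' ->|->] l l' jj' lk l'0; rewrite ?hl ?hm.
    + by apply: fb => //; move: jj'; rewrite !lift_max.
    + have -> : l' = Ordinal (k0 ord_max) by apply: val_inj.
      by have /forallP/(_ l) := fg i; rewrite -ltnS prednK.
    + move: jj'; rewrite lift_max /= => jj'.
      by have : (i' < r)%N := ltn_ord i'; rewrite jj' ltnNge leqnSn.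
    + by move: jj' => /= /esym/eqP; rewrite eqn_leq ltnn.
apply/forallP => j; case: (unliftP ord_max j) => [i ->|->]; apply/forallP => l; rewrite ?hl ?hm.
  have /forallP/(_ l) := fg i => /leq_trans; apply.
  apply: leq_trans (leq_pred _) _.
  by have := gb (Ordinal (k0 ord_max)); rewrite addn0.
by have := gb l; rewrite addn0.
Qed.

(** The sum over earlier blocks sits in the weight of entry [l = 0] because its bound depends on
    that entry alone. *)
Fixpoint block_sum (F : fieldType) (K : nat -> nat) (d : nat -> nat -> nat -> F)
    (r m : nat) : F :=
  if r is r'.+1 then
    chain_sum 0 (fun l t =>
        d r' l t * (if l == 0%N then block_sum K d r' t.-1 else 1)) (K r') m
  else 1.

Lemma block_sumE (F : fieldType) (K : nat -> nat) (d : nat -> nat -> nat -> F)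
    N r (k : 'I_r -> nat) m :
  (forall j, k j = K j) -> (forall j, 0 < k j)%N -> (m <= N)%N ->
  \sum_(n : block_family N k | bounded_block_chain m n)
    \prod_(j < r) \prod_(l < k j) d j l (n j l)
  = block_sum K d r m.
Proof.
elim: r k m => [|r IHr] k m kK k0 mN.
  rewrite (@sum_dffun0 _ _ _ _ (finfun (fun j : 'I_0 => [ffun=> ord0]))) ?big_ord0 //.
  apply/andP; split; last by apply/forallP; case.
  by apply/block_chainP; split; case.
rewrite sum_dffun_recr [RHS]/=.
rewrite -[K r](kK ord_max) -(@chain_sumE _ _ _ N) ?addn0 // [RHS]big_mkcond /=.
apply: eq_bigr => g _.
under eq_bigl do rewrite (bounded_block_chain_rcons k0).
case: ifP => /= [gc|_]; last by rewrite big_pred0_eq.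
set g0 := g _.
pose k' (j : 'I_r) := k (lift ord_max j).
rewrite big_split /=.
(* All factors other than the one at [l = 0] are 1. *)
have -> : \prod_(l < k ord_max)
     (if l == 0%N :> nat then block_sum K d r (g l).-1 else 1)
   = block_sum K d r g0.-1.
  rewrite (bigD1 (Ordinal (k0 ord_max))) //= big1 ?mulr1 // => l.
  by rewrite -val_eqE /=; case: ifP.
rewrite -(IHr k').
- rewrite mulr_sumr; apply: eq_bigr => f _; rewrite big_ord_recr /= mulrC; congr (_ * _).
    by rewrite dffun_rcons_max.
  apply: eq_bigr => j _.
  have -> : widen_ord (leqnSn r) j = lift ord_max j by exact/val_inj/esym/lift_max.
  by rewrite dffun_rcons_lift; apply: eq_bigr => l _; rewrite ?lift_max.
- by move=> j; rewrite /k' kK lift_max.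
- by move=> j; apply: k0.
- by apply: leq_trans (leq_pred _) _; rewrite -ltnS ltn_ord.
Qed.

Lemma spaced_chain_strict N r (n : {ffun 'I_r -> 'I_N.+1}) :
  spaced_chain 1 N.+1 n = strict_chain n.
Proof.
rewrite /spaced_chain /strict_chain; congr (_ && _).
have -> : [forall i, n i + 1 <= N.+1]%N by apply/forallP => i; rewrite addn1 ltn_ord.
by rewrite andbT; apply: eq_forallb => i; apply: eq_forallb => j; rewrite addn1.
Qed.

Lemma bounded_block_chainN N r (k : 'I_r -> nat) (n : block_family N k) :
  bounded_block_chain N n = block_chain n.
Proof.
rewrite /bounded_block_chain (introT forallP) ?andbT // => j.
by apply/forallP => l; rewrite -ltnS.
Qed.

(** * The two sides as evaluations of one iterated weight *)

Section Connection.

Variable F : fieldType.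
Hypothesis natF_neq0 : forall n, n.+1%:R != 0 :> F.
Variables (K : nat -> nat) (Y : nat -> F).

Fixpoint connected_weight j : nat -> F :=
  if j is j'.+1 then attach (Y j') (K j') (connected_weight j')
  else fun n => (n == 0%N)%:R.

(** Each of the [r] steps contributes one block and one sign; the transform of v_0 is constantly
    1. *)
Lemma binomial_transform_connected_weight r m :
  (forall j, j < r -> 0 < K j)%N -> (forall j n, (j < r)%N -> Y j - n.+1%:R != 0) ->
  binomial_transform (connected_weight r) m
  = (-1) ^+ r
    * block_sum K (fun j l t => (if l == 0%N then t%:R - Y j else t%:R)^-1) r m.
Proof.
elim: r m => [|r IHr] m K0 Yn.
  rewrite /binomial_transform big_ord_recl bin0 /= big1 ?addr0 ?mulr1 // => i _.
  by rewrite mul0r.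
rewrite /= -[K r]prednK ?K0 // exprS mulN1r.
apply: binomial_transform_attach => //; first by move=> n; apply: Yn.
move=> p; apply: IHr => [j jr|j n jr]; first by apply: K0; apply: ltnW.
by apply: Yn; apply: ltnW.
Qed.

(** In each ratio the denominator belongs to the [attach] at level [i], while the numerator is the
    weight in the next sum. For [r = 0] the hypothesis [0 < m] ensures that the term [a = 0] is
    present. *)
Lemma strict_chain_connected_weight r m : (0 < m)%N ->
  chain_sum 1 (fun i n => (n%:R ^+ K i)^-1
     * (gbinom (Y i.+1 - 1) n / gbinom (Y i - 1) n)) r m
  = \sum_(a < m) connected_weight r a * gbinom (Y r - 1) a.
Proof.
elim: r m => [|r IHr] [|m] // _.
  rewrite big_ord_recl /= {1}/gbinom big_ord0 fact0 divr1 mulr1 big1 ?addr0 // => i _.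
  by rewrite mul0r.
rewrite /= big_ord_recl {1}/attach big_ord0 mulr0 mul0r add0r.
rewrite subSS subn0 big_add1 /= big_mkord; apply: eq_bigr => i _.
by rewrite IHr // /attach /bump /= add1n; ring.
Qed.

End Connection.

(** * Nonvanishing of denominators in the field of rational functions, and the identity *)

Lemma ratfun_natr_neq0 r n : n.+1%:R != 0 :> ratfun r.
Proof.
rewrite -(rmorph_nat (@tofrac {mpoly rat[r]})) tofrac_eq0.
by rewrite -(rmorph_nat (@mpolyC r rat)) mpolyC_eq0 Num.Theory.pnatr_eq0.
Qed.

Lemma indet_neq_nat r (i : 'I_r) N n : (0 < N)%N ->
  N%:R * indet i - n%:R != 0.
Proof.
move=> N0.
rewrite /indet -(rmorph_nat (@tofrac {mpoly rat[r]}) N)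
  -(rmorph_nat (@tofrac {mpoly rat[r]}) n).
rewrite -rmorphM -rmorphB tofrac_eq0.
(* The coefficient of the indeterminate itself is [N], which is nonzero. *)
apply/eqP => /mpolyP/(_ U_(i)%MM)/eqP.
rewrite mcoeff0 mcoeffB mulr_natl mcoeffMn mcoeffX eqxx.
rewrite -(rmorph_nat (@mpolyC r rat)) mcoeffC mnm1_eq0 mulr0 subr0.
by rewrite Num.Theory.pnatr_eq0 eqn0Ngt N0.
Qed.

(* The depth of the index is r.+1 >= 1. *)
Theorem theorem2p1 (r : nat) (k : 'I_r.+1 -> nat)
    (k_gt0 : forall i, (0 < k i)%N) (N : nat) (N_gt0 : (0 < N)%N) :
  let x : 'I_r.+1 -> ratfun r.+1 := @indet r.+1 in
  \sum_(n : {ffun 'I_r.+1 -> 'I_N.+1} | strict_chain n)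
     (\prod_(i < r.+1) ((n i)%:R ^+ k i))^-1
     * (\prod_(i < r)
          (gbinom (N%:R * x (lift ord0 i) - 1) (n (widen_ord (leqnSn r) i))
           / gbinom (N%:R * x (widen_ord (leqnSn r) i) - 1)
                    (n (widen_ord (leqnSn r) i))))
     * (gbinom (N%:R : ratfun r.+1) (n ord_max)
        / gbinom (N%:R * x ord_max - 1) (n ord_max))
  = (-1) ^+ r.+1 *
    \sum_(n : block_family N k | block_chain n)
      \prod_(j < r.+1)
        (\prod_(l < k j)
           (if l == 0%N :> nat then (n j l)%:R - N%:R * x j
            else (n j l)%:R))^-1.
Proof.
move=> x.
have nat0 := @ratfun_natr_neq0 r.+1.
(* The recursive sums take indices in [nat], so [inord] extends the exponents. *)
pose K i := k (inord i).
(* The junk value N + 1 at index r.+1 turns the last numerator binom(N, n) into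
   binom(y_(r+1) - 1, n), like all the others. *)
pose Y i : ratfun r.+1 := if (i <= r)%N then N%:R * x (inord i) else N%:R + 1.
have YE (i : 'I_r.+1) : Y i = N%:R * x i.
  by rewrite /Y -ltnS ltn_ord inord_val.
have YN : Y r.+1 - 1 = N%:R by rewrite /Y ltnn addrK.
have Yn j n : (j < r.+1)%N -> Y j - n.+1%:R != 0.
  by rewrite ltnS /Y => ->; apply: indet_neq_nat.
transitivity (chain_sum 1 (fun i n => (n%:R ^+ K i)^-1
     * (gbinom (Y i.+1 - 1) n / gbinom (Y i - 1) n)) r.+1 N.+1).
  rewrite -(@chain_sumE _ _ _ N) ?addn1 //.
  under [RHS]eq_bigl do rewrite spaced_chain_strict.
  apply: eq_bigr => n _; rewrite [RHS]big_split /= -mulrA; congr (_ * _).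
    by rewrite [RHS]prodfV; congr _^-1; apply: eq_bigr => i _; rewrite /K inord_val.
  rewrite big_ord_recr /= YN (YE ord_max); congr (_ * _).
  apply: eq_bigr => i _.
  by rewrite (YE (widen_ord (leqnSn r) i)) -(YE (lift ord0 i)) lift0.
rewrite strict_chain_connected_weight //.
(* As [Y r.+1 - 1] is [N], the remaining weight of [a] is the ordinary binomial coefficient
   ['C(N, a)]. *)
transitivity (binomial_transform (connected_weight K Y r.+1) N).
  by apply: eq_bigr => a _; rewrite YN gbinom_nat.
rewrite binomial_transform_connected_weight //; last by move=> j _; apply: k_gt0.
rewrite -(@block_sumE _ _ _ N _ k) //; last by move=> j; rewrite /K inord_val.
congr (_ * _); apply: eq_big => [n|n _]; first exact: bounded_block_chainN.
apply: eq_bigr => j _; rewrite prodfV; congr _^-1.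
by apply: eq_bigr => l _; rewrite YE.
Qed.
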